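(* Let $d\ge 2$ be an integer and let $2d-2$ distinct lines in $\mathbb{CP}^d$ be given, each of which is tangent to the rational normal curve $E$ at a real point (a point $E(z)$ with $z\in\mathbb{R}\cup\{\infty\}$). Then every projective subspace of $\mathbb{CP}^d$ of codimension $2$ which intersects all of these $2d-2$ lines is real.
   Context: The rational normal curve is the map $E:\mathbb{CP}^1\to\mathbb{CP}^d$, $E(z)=(1:z:\dots:z^d)$ (with $E(\infty)=(0:\dots:0:1)$). A projective subspace of $\mathbb{CP}^d$ is real if it can be defined by linear equations with real coefficients in the homogeneous coordinates. *)

(* Defs.v *)
From HB Require Import structures.
From mathcomp Require Import all_boot all_order all_algebra.
From mathcomp Require Import all_reals.
From mathcomp.real_closed Require Import complex.

Set Implicit Arguments.
Unset Strict Implicit.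
Unset Printing Implicit Defensive.

Import Order.TTheory GRing.Theory Num.Theory.

Local Open Scope ring_scope.

(* CP^d is the set of lines of C^(d+1), written as row vectors; a projective
   subspace is a linear subspace of C^(d+1), its projective dimension being
   the linear dimension minus one. The Riemann sphere CP^1 (resp. RP^1) is
   [option C] (resp. [option R]), with [None] as the point at infinity. *)

Section RationalNormalCurve.
Variables (F : fieldType) (d : nat).

Definition rnc (z : option F) : 'rV[F]_d.+1 :=
  if z is Some a then \row_(i < d.+1) a ^+ i else delta_mx 0 ord_max.

(* A polynomial lift of E in a chart of CP^1 around z: the coordinate is z
   itself at finite points, where E = (1 : z : ... : z^d), and w = 1/z at
   infinity, where E = (w^d : w^(d-1) : ... : 1). *)
Definition rnc_lift (z : option F) : 'rV[{poly F}]_d.+1 :=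
  if z is Some _ then \row_(i < d.+1) 'X^i else \row_(i < d.+1) 'X^(d - i).

Definition chart_coord (z : option F) : F := odflt 0 z.

Lemma rnc_liftE (z : option F) :
  map_mx (fun p : {poly F} => p.[chart_coord z]) (rnc_lift z) = rnc z.
Proof.
case: z => [a|]; apply/rowP => i; rewrite !mxE ?hornerXn //= expr0n subn_eq0.
by rewrite -val_eqE /= eqn_leq -[(i <= d)%N]ltnS ltn_ord.
Qed.

Definition rnc_velocity (z : option F) : 'rV[F]_d.+1 :=
  map_mx (fun p : {poly F} => p^`().[chart_coord z]) (rnc_lift z).

Definition rnc_tangent_line (z : option F) : {vspace 'rV[F]_d.+1} :=
  <<[:: rnc z; rnc_velocity z]>>%VS.

(* The projective subspaces P(U) and P(V) share a point. *)
Definition proj_intersect (U V : {vspace 'rV[F]_d.+1}) : Prop :=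
  exists x : 'rV[F]_d.+1, [/\ x != 0, x \in U & x \in V].

End RationalNormalCurve.

(* V is the solution set of finitely many linear equations with real
   coefficients; each column of A is one equation. *)
Definition real_subspace (R : realType) (d : nat)
    (V : {vspace 'rV[R[i]]_d.+1}) : Prop :=
  exists (m : nat) (A : 'M[R]_(d.+1, m)),
    forall x : 'rV[R[i]]_d.+1,
      x \in V <-> x *m map_mx (real_complex R) A = 0.

(* Main.v *)
Require Import Defs.
From mathcomp Require Import all_boot all_order all_algebra.
From mathcomp Require Import all_fingroup.
From mathcomp Require Import all_reals.
From mathcomp.real_closed Require Import complex.
From mathcomp Require Import ring zify.

Set Implicit Arguments.
Unset Strict Implicit.
Unset Printing Implicit Defensive.

Import Order.TTheory GRing.Theory Num.Theory.

Local Open Scope ring_scope.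

(** A subspace V of codimension 2 is cut out by two linear forms, that is, by a
    pencil spanned by polynomials p and q of degree at most d, and V meets the
    tangent line at z exactly when the Wronskian p q' - p' q vanishes at z
    ([tangent_line_hwronskian]). The Wronskian has degree at most 2d - 2, so the
    2d - 2 given real points are all its zeros, and they are simple. It remains
    to show that a pencil whose Wronskian has these zeros is real.

    A real Moebius transformation sends a real point x to infinity and turns the
    member p(x) q - q(x) p of the pencil, which vanishes at x, into a polynomial
    of degree m = d - 1 ([to_infty_wronskian]). If x avoids the zeros of a
    certain polynomial, this member does not vanish at the 2m zeros z_k of the
    Wronskian, so that its roots t_1, ..., t_m are simple and differ from the
    z_k. The relation between the first two derivatives of the member and of the
    Wronskian at t_i gives the Bethe equations of the Gaudin model of sl_2,

      sum_k 1 / (z_k - t_i) = sum_(j != i) 2 / (t_j - t_i).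

    They make the Bethe vector, with coordinates the permanents
    perm (1 / (z_(g i) - t_j)) for g an injection of {1..m} into {1..2m}, an
    eigenvector of the Gaudin Hamiltonians
    H_k = sum_(j != k) (transposition of k and j) / (z_k - z_j)
    ([cauchy_perm_move_out], [cauchy_perm_move_in]). This vector is nonzero
    ([cauchy_perm_neq0]) and H_k is real and symmetric, so the eigenvalue is real
    ([real_eigenvalue]). Thus the logarithmic derivative of the member P is real
    at each z_k ([gaudin_real]), so the Wronskian of P and its complex conjugate
    vanishes at 2m points. Its degree is less than 2m, hence it is zero and P is
    real up to a scalar ([pencil_member_real]).

    Two generic values of x give a real basis of the pencil ([real_basis]). *)

(** * Permanents of Cauchy matrices *)

Section CauchyPermanent.
Variable F : numFieldType.

(** The permanent of the Cauchy matrix with entries 1 / (x_i - t_j). *)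
Definition cauchy_perm m (t x : 'I_m -> F) : F :=
  \sum_(s : 'S_m) \prod_i (x i - t (s i))^-1.

Definition upd m (x : 'I_m -> F) i0 y := fun i => if i == i0 then y else x i.

Lemma eq_cauchy_perm m (t x x' : 'I_m -> F) :
  x =1 x' -> cauchy_perm t x = cauchy_perm t x'.
Proof.
by move=> e; apply: eq_bigr => s _; apply: eq_bigr => i _; rewrite e.
Qed.

Lemma prod_upd m (t x : 'I_m -> F) (s : 'S_m) i0 y :
  (forall i j, x i != t j) ->
  \prod_i (upd x i0 y i - t (s i))^-1 =
  (x i0 - t (s i0)) / (y - t (s i0)) * \prod_i (x i - t (s i))^-1.
Proof.
move=> xt; rewrite (bigD1 i0) //= [in RHS](bigD1 i0) //= {1}/upd eqxx.
rewrite -[in LHS](_ : \prod_(i | i != i0) (x i - t (s i))^-1 = \prod_(i | i != i0) (upd x i0 y i - t (s i))^-1).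
  by rewrite mulrACA divff ?mul1r // subr_eq0.
by apply: eq_bigr => i /negPf ne; rewrite /upd ne.
Qed.

(** Replacing x_i by y multiplies the term of s by a homography in y whose
    quotient by y - x_i splits into 1 / (y - x_i) - 1 / (y - t_(s i)). This is
    the action of a Gaudin Hamiltonian at a site y that carries no x_i. *)
Lemma cauchy_perm_move_out m (t x : 'I_m -> F) y :
  (forall i j, x i != t j) -> (forall i, y != x i) -> (forall i, y != t i) ->
  \sum_i cauchy_perm t (upd x i y) / (y - x i) =
  (\sum_i (y - x i)^-1 - \sum_i (y - t i)^-1) * cauchy_perm t x.
Proof.
move=> xt yx yt.
under eq_bigr do rewrite mulr_suml.
rewrite exchange_big mulr_sumr; apply: eq_bigr => s _ /=.
rewrite [\sum_i (y - t i)^-1](reindex_inj (@perm_inj _ s)) /=.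
rewrite -sumrB mulr_suml; apply: eq_bigr => i _.
rewrite prod_upd // mulrAC; congr (_ * _).
by field; rewrite !subr_eq0 yx yt.
Qed.

(** The terms of s and of s composed with the transposition of i0 and j are
    opposite. *)
Lemma cauchy_perm_swap m (t x : 'I_m -> F) i0 j :
  (forall i j, x i != t j) -> injective t -> i0 != j ->
  \sum_(s : 'S_m)
    (2 / (t (s j) - t (s i0)) - (x j - t (s i0))^-1 + (x i0 - t (s j))^-1)
    * \prod_i (x i - t (s i))^-1 = 0 :> F.
Proof.
move=> xt t_inj ij; set f := BIG_F.
have pair s : f s + f (tperm i0 j * s)%g = 0.
  have ne : j != i0 by rewrite eq_sym.
  rewrite /f !permM tpermL tpermR (bigD1 i0) //= (bigD1 j) //=.
  rewrite [X in _ + _ * X](bigD1 i0) //= [X in _ + _ * (_ * X)](bigD1 j) //=.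
  rewrite !permM tpermL tpermR.
  under [in X in _ + X]eq_bigr => k /andP[ki kj].
    rewrite permM tpermD 1?eq_sym //; over.
  set P := \prod_(k | _) _; field.
  by rewrite !subr_eq0 !xt !(inj_eq t_inj) !(inj_eq perm_inj) ij ne.
have S2 : (\sum_s f s) = - (\sum_s f s).
  rewrite -[RHS]sumrN (reindex_inj (mulgI (tperm i0 j))).
  by apply: eq_bigr => s _; apply/eqP; rewrite -addr_eq0 addrC pair.
have : (\sum_s f s) *+ 2 == 0 by rewrite mulr2n {1}S2 addNr.
by rewrite mulrn_eq0 => /eqP.
Qed.

(** The action of a Gaudin Hamiltonian at an occupied site x_i0: the partial
    fractions leave a sum over the free sites y_j, which the Bethe equations
    turn into one over the other roots t; [cauchy_perm_swap] cancels it. *)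
Lemma cauchy_perm_move_in m (t x : 'I_m -> F) i0 (J : finType) (A : pred J)
    (y : J -> F) :
  (forall i j, x i != t j) -> injective t ->
  (forall j, A j -> y j != x i0) -> (forall j i, A j -> y j != t i) ->
  (forall i, \sum_(j | A j) (y j - t i)^-1 + \sum_j (x j - t i)^-1 =
             \sum_(j | j != i) 2 / (t j - t i)) ->
  \sum_(j | A j) cauchy_perm t (upd x i0 (y j)) / (x i0 - y j) =
  (\sum_(j | A j) (x i0 - y j)^-1 - \sum_i (x i0 - t i)^-1) * cauchy_perm t x.
Proof.
move=> xt t_inj yx yt bethe.
under eq_bigr do rewrite mulr_suml.
rewrite exchange_big mulr_sumr /=.
have step (s : 'S_m) : \sum_(j | A j)
    \prod_i (upd x i0 (y j) i - t (s i))^-1 / (x i0 - y j) =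
    (\sum_(j | A j) (x i0 - y j)^-1 - \sum_i (x i0 - t i)^-1)
      * \prod_i (x i - t (s i))^-1
    + \sum_(j | j != i0) 
       (2 / (t (s j) - t (s i0)) - (x j - t (s i0))^-1 + (x i0 - t (s j))^-1)
      * \prod_i (x i - t (s i))^-1.
  rewrite -mulr_suml -mulrDl.
  transitivity ((\sum_(j | A j) (x i0 - y j)^-1
     + \sum_(j | A j) (y j - t (s i0))^-1) * \prod_i (x i - t (s i))^-1).
    rewrite -big_split mulr_suml /=; apply: eq_bigr => j Aj.
    rewrite prod_upd // mulrAC; congr (_ * _).
    by field; rewrite !subr_eq0 [x i0 == _]eq_sym yx ?yt.
  congr (_ * _); rewrite -addrA; congr (_ + _).
  rewrite big_split sumrB /=.
  rewrite [\sum_i (x i0 - t i)^-1](reindex_inj (@perm_inj _ s)) /=.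
  rewrite (bigD1 i0) //= (eqP (_ : \sum_(j | j != i0) 2 / _ ==
    \sum_(j | j != s i0) 2 / (t j - t (s i0)))); last first.
    rewrite [in X in _ == X](reindex_inj (@perm_inj _ s)) /=.
    by apply/eqP/eq_bigl => j; rewrite (inj_eq perm_inj).
  rewrite -bethe [\sum_j (x j - t (s i0))^-1](bigD1 i0) //=.
  by ring.
under eq_bigr do rewrite step.
rewrite big_split /= [X in _ + X]exchange_big [X in _ + X]big1 ?addr0 //=.
by move=> j ji; apply: cauchy_perm_swap; rewrite // eq_sym.
Qed.

(** The permutations are grouped according to the image of the first index. *)
Lemma cauchy_perm_expand m (t x : 'I_m.+1 -> F) :
  cauchy_perm t x =
  \sum_j cauchy_perm (t \o lift j) (x \o lift ord0) / (x ord0 - t j).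
Proof.
rewrite /cauchy_perm (partition_big (fun s : 'S_m.+1 => s ord0) predT) //=.
apply: eq_bigr => j _; rewrite (reindex (lift_perm ord0 j)) /=; last first.
  pose low (s : 'S_m.+1) k := odflt k (unlift (s ord0) (s (lift ord0 k))).
  have lowK (s : 'S_m.+1) k : lift (s ord0) (low s k) = s (lift ord0 k).
    rewrite /low; have := neq_lift ord0 k.
    by rewrite -(can_eq (permK s)) => /unlift_some[] ? ? ->.
  have inj_low s : injective (low s).
    move=> k k' /(congr1 (lift (s ord0))); rewrite !lowK.
    by move/perm_inj/lift_inj.
  exists (fun s => perm (@inj_low s)) => [s _ | s].
    by apply/permP=> k; rewrite permE /low lift_perm_lift lift_perm_id liftK.
  move/eqP => s0; apply/permP=> k.
  case: (unliftP ord0 k) => [k'|] ->; rewrite ?lift_perm_id //.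
  by rewrite lift_perm_lift -s0 permE lowK.
rewrite mulr_suml; apply: eq_big => [s|s _]; first by rewrite lift_perm_id eqxx.
rewrite big_ord_recl lift_perm_id mulrC; congr (_ / _).
by apply: eq_bigr => i _ /=; rewrite lift_perm_lift.
Qed.

(** Points are added one at a time. As a function of the new point, the
    permanent expanded along the row of that point is a rational function whose
    numerator is nonzero of degree at most m, so it does not vanish at all of the
    n - m points z_k that are still free. *)
Lemma cauchy_perm_neq0 m n (t : 'I_m -> F) (z : 'I_n -> F) :
  injective t -> injective z -> (forall i k, z k != t i) -> (m.*2 <= n)%N ->
  exists g : 'I_m -> 'I_n, injective g /\ cauchy_perm t (z \o g) != 0.
Proof.
move=> t_inj z_inj zt; elim: m t t_inj zt => [|m IH] t t_inj zt mn.
  exists (fun i : 'I_0 => match i with Ordinal _ h => False_rect _ (notF h) end).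
  split=> [[]//|]; rewrite /cauchy_perm (eq_bigr (fun _ => 1)).
    by rewrite sumr_const card_Sn oner_eq0.
  by move=> s _; rewrite big_ord0.
have [|i k|//|g [g_inj g_neq0]] := IH (t \o lift ord0).
- by apply: inj_comp => //; apply: lift_inj.
- exact: zt.
- by apply: leq_trans mn; rewrite leq_double.
pose c j := cauchy_perm (t \o lift j) (z \o g).
pose P : {poly F} := \sum_j c j *: \prod_(i | i != j) ('X - (t i)%:P).
have P0 : P.[t ord0] != 0.
  rewrite horner_sum (bigD1 ord0) //= [X in _ + X]big1 => [|j j0].
    rewrite addr0 hornerZ horner_prod mulf_neq0 //.
    apply/prodf_neq0 => i i0.
    by rewrite hornerXsubC subr_eq0 (inj_eq t_inj) eq_sym.
  rewrite hornerZ horner_prod (bigD1 ord0) /= 1?eq_sym //.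
  by rewrite hornerXsubC subrr mul0r mulr0.
have sizeP : (size P <= m.+1)%N.
  apply: leq_trans (size_sum _ _ _) _; apply/bigmax_leqP => j _.
  apply: leq_trans (size_scale_leq _ _) _.
  rewrite size_prod => [|i _]; last by rewrite polyXsubC_eq0.
  under eq_bigr do rewrite size_XsubC.
  by rewrite sum_nat_const muln2 -addnn -addSn addnK cardC1 card_ord.
pose rs := [seq z k | k in [predC mem (codom g)]].
have [k kg Pk] : exists2 k, k \notin codom g & P.[z k] != 0.
  apply/exists_inP; apply: contraNT P0 => /exists_inPn Pz.
  rewrite (@roots_geq_poly_eq0 _ P rs) ?horner0 //.
  - by apply/allP => _ /imageP[k kg ->]; have := Pz _ kg; rewrite negbK.
  - by rewrite map_inj_uniq ?enum_uniq.
  apply: leq_trans sizeP _; rewrite size_image.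
  have := cardC (mem (codom g)); rewrite card_codom // !card_ord => e.
  have {}e : (m + #|[predC mem (codom g)]| = n)%N by rewrite -[RHS]e.
  by rewrite -(leq_add2l m) e; apply: leq_trans mn; rewrite -addnn addSn leqnSn.
pose g' i := if unlift ord0 i is Some j then g j else k.
exists g'; split=> [i i'|].
  rewrite /g'; case: unliftP => [j|] ->; case: unliftP => [j'|] -> //.
  - by move/g_inj ->.
  - by move=> e; case/negP: kg; rewrite -e codom_f.
  - by move=> e; case/negP: kg; rewrite e codom_f.
rewrite cauchy_perm_expand /= {2}/g' unlift_none.
have -> : \sum_j cauchy_perm (t \o lift j) ((z \o g') \o lift ord0) / (z k - t j)
    = P.[z k] / \prod_i (z k - t i).
  rewrite horner_sum mulr_suml; apply: eq_bigr => j _.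
  rewrite hornerZ horner_prod [X in _ = _ / X](bigD1 j) //= -[RHS]mulrA; congr (_ * _).
    by apply: eq_cauchy_perm => i /=; rewrite /g' liftK.
  under eq_bigr do rewrite hornerXsubC.
  rewrite invfM mulrCA divff ?mulr1 //; apply/prodf_neq0 => i _.
  by rewrite subr_eq0.
rewrite mulf_neq0 ?invr_eq0 //; apply/prodf_neq0 => i _.
by rewrite subr_eq0.
Qed.

Lemma cauchy_perm_sym m (t x : 'I_m -> F) (u : 'S_m) :
  cauchy_perm t (x \o u) = cauchy_perm t x.
Proof.
rewrite [RHS](reindex_inj (mulgI u^-1%g)); apply: eq_bigr => s _ /=.
rewrite [RHS](reindex_inj (@perm_inj _ u)); apply: eq_bigr => i _ /=.
by rewrite permM permK.
Qed.

End CauchyPermanent.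

(** * Reality of the eigenvalues of the Gaudin Hamiltonians *)

Section Gaudin.
Variable C : numClosedFieldType.

(** The operator sum_j a_j (composition with tau_j) is Hermitian, being a real
    combination of permutation operators whose square is the identity. *)
Lemma real_eigenvalue (G J : finType) (v : G -> C) (h : C) (a : J -> C)
    (tau : J -> G -> G) :
  (forall j, a j \is Num.real) -> (forall j, involutive (tau j)) ->
  (forall g, h * v g = \sum_j a j * v (tau j g)) ->
  (exists g, v g != 0) -> h \is Num.real.
Proof.
move=> a_real tauK eig [g0 g0P]; apply/CrealP.
pose N := \sum_g v g * (v g)^*.
have N0 : N != 0.
  rewrite psumr_neq0 => [|g _]; last by rewrite mul_conjC_ge0.
  by apply/hasP; exists g0; rewrite ?mem_index_enum //= mul_conjC_gt0.
have hN : h * N = \sum_g \sum_j a j * v (tau j g) * (v g)^*.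
  by rewrite mulr_sumr; apply: eq_bigr => g _; rewrite mulrA eig mulr_suml.
have NJ : N^* = N.
  by rewrite rmorph_sum; apply: eq_bigr => g _; rewrite rmorphM /= conjCK mulrC.
apply: (mulIf N0); rewrite -{1}NJ -rmorphM hN rmorph_sum.
under eq_bigr do rewrite rmorph_sum.
rewrite exchange_big [RHS]exchange_big; apply: eq_bigr => j _ /=.
rewrite (reindex_inj (inv_inj (tauK j))); apply: eq_bigr => g _ /=.
by rewrite !rmorphM /= conjCK tauK (conj_Creal (a_real j)) -!mulrA [_^* * _]mulrC.
Qed.

Lemma sum_codom (I J : finType) (f : I -> J) (E : J -> C) :
  injective f -> \sum_(j | j \in codom f) E j = \sum_i E (f i).
Proof.
move=> f_inj; rewrite -big_uniq ?big_image //=.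
by rewrite map_inj_uniq ?enum_uniq.
Qed.

(** The sum is, up to a real number, minus the eigenvalue of the k-th Hamiltonian
    on the Bethe vector. *)
Lemma gaudin_real m n (t : 'I_m -> C) (z : 'I_n -> C) :
  injective t -> injective z -> (forall k, z k \is Num.real) ->
  (forall i k, z k != t i) -> (m.*2 <= n)%N ->
  (forall i, \sum_k (z k - t i)^-1 = \sum_(j | j != i) 2 / (t j - t i)) ->
  forall k, \sum_i (z k - t i)^-1 \is Num.real.
Proof.
move=> t_inj z_inj z_real zt mn bethe k.
(* The weight a k is 0, since 0 has inverse 0. *)
pose a j := (z k - z j)^-1.
have a_real j : a j \is Num.real by rewrite realV realB.
pose tau j (g : {ffun 'I_m -> 'I_n}) : {ffun 'I_m -> 'I_n} := [ffun i => tperm k j (g i)].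
have tauK j : involutive (tau j).
  by move=> g; apply/ffunP => i; rewrite !ffunE tpermK.
have tau_inj j g : injectiveb (tau j g) = injectiveb g.
  have imp (g' : {ffun 'I_m -> 'I_n}) : injectiveb g' -> injectiveb (tau j g').
    move=> /injectiveP g_inj; apply/injectiveP => i i'.
    by rewrite !ffunE => /perm_inj/g_inj.
  by apply/idP/idP => /imp; rewrite ?tauK.
(* Transpositions preserve injectivity, so the vector may be extended by 0. *)
pose v (g : {ffun 'I_m -> 'I_n}) := if injectiveb g then cauchy_perm t (z \o g) else 0.
suff : \sum_j a j - \sum_i (z k - t i)^-1 \is Num.real.
  by rewrite rpredBl // rpred_sum.
apply: (@real_eigenvalue _ _ v _ a tau) => // [g|]; last first.
  have [g [g_inj g0]] := cauchy_perm_neq0 t_inj z_inj zt mn.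
  exists (finfun g).
  have e : finfun g =1 g by move=> i; rewrite ffunE.
  rewrite /v; case: injectiveP => [_|[]]; last exact: eq_inj g_inj (fsym e).
  by rewrite (@eq_cauchy_perm _ _ _ _ (z \o g)) // => i /=; rewrite e.
rewrite /v; under [RHS]eq_bigr do rewrite tau_inj.
case: injectiveP => [g_inj|_]; last first.
  by rewrite mulr0 big1 // => j _; rewrite mulr0.
have xt i j : z (g i) != t j by [].
rewrite (bigID (fun j => j \in codom g)) [in RHS](bigID (fun j => j \in codom g)) /=.
rewrite !sum_codom //.
(* Exchanging k with an occupied site permutes the points when k is occupied;
   exchanging it with a free site does nothing when k is free. *)
have [/codomP[i0 k_def]|kg] := boolP (k \in codom g).
  have -> : \sum_i a (g i) * cauchy_perm t (z \o tau (g i) g) =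
      \sum_i a (g i) * cauchy_perm t (z \o g).
    apply: eq_bigr => i _; congr (_ * _).
    rewrite -(cauchy_perm_sym _ (z \o g) (tperm i0 i)).
    apply: eq_cauchy_perm => i' /=; rewrite ffunE k_def; congr z.
    by rewrite inj_tperm.
  have -> : \sum_(j | j \notin codom g) a j * cauchy_perm t (z \o tau j g) =
      \sum_(j | j \notin codom g)
         cauchy_perm t (upd (z \o g) i0 (z j)) / (z (g i0) - z j).
    apply: eq_bigr => j jg; rewrite mulrC -k_def; congr (_ / _).
    apply: eq_cauchy_perm => i /=; rewrite ffunE /upd k_def.
    have [->|ne] := eqVneq i i0; first by rewrite tpermL.
    rewrite tpermD //; first by rewrite (inj_eq g_inj) eq_sym.
    by apply: contraNneq jg => ->; apply: codom_f.
  rewrite (@cauchy_perm_move_in _ _ t (z \o g)) //=.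
  - by rewrite -mulr_suml -k_def -mulrDl addrA.
  - by move=> j jg; rewrite (inj_eq z_inj); apply: contraNneq jg => ->; apply: codom_f.
  - by move=> i; rewrite -bethe [RHS](bigID (fun j => j \in codom g)) /= sum_codom // addrC.
have -> : \sum_(j | j \notin codom g) a j * cauchy_perm t (z \o tau j g) =
      \sum_(j | j \notin codom g) a j * cauchy_perm t (z \o g).
  apply: eq_bigr => j jg; congr (_ * _); apply: eq_cauchy_perm => i /=.
  rewrite ffunE tpermD //.
    by apply: contraNneq kg => ->; apply: codom_f.
  by apply: contraNneq jg => ->; apply: codom_f.
have -> : \sum_i a (g i) * cauchy_perm t (z \o tau (g i) g) =
    \sum_i cauchy_perm t (upd (z \o g) i (z k)) / (z k - z (g i)).
  apply: eq_bigr => i _; rewrite mulrC; congr (_ / _).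
  apply: eq_cauchy_perm => i' /=; rewrite ffunE /upd.
  have [->|ne] := eqVneq i' i; first by rewrite tpermR.
  rewrite tpermD //; last by rewrite (inj_eq g_inj) eq_sym.
  by apply: contraNneq kg => ->; apply: codom_f.
rewrite (@cauchy_perm_move_out _ _ t (z \o g)) //=.
  by rewrite -mulr_suml -mulrDl addrAC.
by move=> i; rewrite (inj_eq z_inj); apply: contraNneq kg => ->; apply: codom_f.
Qed.

End Gaudin.
(** * Wronskians *)

Section Wronskian.
Variable F : numFieldType.
Implicit Types p q : {poly F}.

Definition wronskian p q := p * q^`() - p^`() * q.

Lemma wronskian_comb a b c e p q :
  wronskian (a *: p + b *: q) (c *: p + e *: q) = (a * e - b * c) *: wronskian p q.
Proof.
rewrite /wronskian !derivE -!mul_polyC polyCB !polyCM.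
by ring.
Qed.

Lemma coefM_top p q a b : (size p <= a.+1)%N -> (size q <= b.+1)%N ->
  (p * q)`_(a + b) = p`_a * q`_b.
Proof.
move=> sp sq; have lt_a : (a < (a + b).+1)%N by rewrite ltnS leq_addr.
rewrite coefM (bigD1 (Ordinal lt_a)) //= addKn big1 ?addr0 // => j.
rewrite -val_eqE /= neq_ltn => /orP[lt_j|gt_j].
  rewrite [q`__]nth_default ?mulr0 // (leq_trans sq) //.
  by rewrite -(ltn_add2l j) subnKC ?ltn_add2r // -ltnS.
by rewrite [p`__]nth_default ?mul0r // (leq_trans sp).
Qed.

Lemma coefXderiv p i : ('X * p^`())`_i = i%:R * p`_i.
Proof.
by case: i => [|i]; rewrite coefXM ?mul0r //= coef_deriv mulr_natl.
Qed.

Lemma size_Xderiv p n : (size p <= n)%N -> (size ('X * p^`())%R <= n)%N.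
Proof.
move=> /leq_sizeP sp; apply/leq_sizeP => i ni.
by rewrite coefXderiv sp ?mulr0.
Qed.

(** X times the Wronskian is p (X q') - (X p') q, and the Euler operator
    p |-> X p' multiplies the i-th coefficient by i. *)
Lemma coef_Xwronskian p q a b : (size p <= a.+1)%N -> (size q <= b.+1)%N ->
  ('X * wronskian p q)`_(a + b) = (b%:R - a%:R) * (p`_a * q`_b).
Proof.
move=> sp sq; rewrite /wronskian mulrBr mulrCA [X in _ - X]mulrA coefB.
rewrite !coefM_top ?size_Xderiv // !coefXderiv.
by ring.
Qed.

Lemma size_wronskian p q a b : (size p <= a.+1)%N -> (size q <= b.+1)%N ->
  (size (wronskian p q) <= a + b)%N.
Proof.
move=> sp sq; have [->|W0] := eqVneq (wronskian p q) 0; first by rewrite size_poly0.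
rewrite -ltnS -size_mulX // mulrC /wronskian mulrBr mulrCA [X in _ - X]mulrA.
have szM p' q' : (size p' <= a.+1)%N -> (size q' <= b.+1)%N ->
    (size (p' * q')%R <= (a + b).+1)%N.
  move=> sp' sq'; apply: leq_trans (size_polyMleq _ _) _.
  rewrite -subn1 leq_subLR (leq_trans (leq_add sp' sq')) //.
  by rewrite addSn addnS add1n.
rewrite (leq_trans (size_polyD _ _)) // size_polyN geq_max.
by rewrite !szM ?size_Xderiv.
Qed.

Lemma wronskian_top_eq0 p q a b : (size p <= a.+1)%N -> (size q <= b.+1)%N ->
  (b%:R - a%:R) * (p`_a * q`_b) = 0 -> (size (wronskian p q) <= (a + b).-1)%N.
Proof.
move=> sp sq; rewrite -coef_Xwronskian // coefXM.
have := size_wronskian sp sq; case: (a + b)%N => // n sW /= Wn.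
apply/leq_sizeP => i; rewrite leq_eqVlt => /predU1P[<-//|ni].
by rewrite nth_default // (leq_trans sW).
Qed.

Lemma size_wronskian_diag p q a : (size p <= a.+1)%N -> (size q <= a.+1)%N ->
  (size (wronskian p q) <= (a + a).-1)%N.
Proof. by move=> sp sq; apply: wronskian_top_eq0; rewrite // subrr mul0r. Qed.

(** The leading term forces two nonzero polynomials with zero Wronskian to have
    the same degree; subtracting from q the multiple of p with the same leading
    term lowers the degree, so the difference is zero. *)
Lemma wronskian_eq0 p q :
  p != 0 -> wronskian p q = 0 -> exists c, q = c *: p.
Proof.
have eq_size q' : p != 0 -> q' != 0 -> wronskian p q' = 0 -> size q' = size p.
  move=> p0 q0 W0; have := @coef_Xwronskian p q' (size p).-1 (size q').-1.
  rewrite W0 mulr0 coef0 !prednK ?size_poly_gt0 // => /(_ (leqnn _) (leqnn _)).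
  move/esym/eqP; rewrite !mulf_eq0 ![_`_ _ == 0]lead_coef_eq0.
  rewrite (negPf p0) (negPf q0) !orbF subr_eq0 eqr_nat => /eqP e.
  by rewrite -[LHS]prednK ?size_poly_gt0 // e prednK ?size_poly_gt0.
move=> p0 W0; exists (lead_coef q / lead_coef p).
have [->|q0] := eqVneq q 0; first by rewrite lead_coef0 mul0r scale0r.
set c := _ / _; apply/eqP; rewrite -subr_eq0; apply: contraT => r0.
have c0 : c != 0 by rewrite mulf_neq0 ?invr_eq0 ?lead_coef_eq0.
have/eq_size : wronskian p (q - c *: p) = 0.
  have := wronskian_comb 1 0 (- c) 1 p q.
  by rewrite scale1r scale0r addr0 scaleNr W0 scaler0 scale1r addrC.
move=> /(_ p0 r0) /eqP; rewrite eqn_leq => /andP[_]; rewrite leqNgt => /negP[].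
have sp := eq_size _ p0 q0 W0.
rewrite -[size p]prednK ?size_poly_gt0 // ltnS; apply/leq_sizeP => i.
rewrite leq_eqVlt => /predU1P[<-|lt_i].
  by rewrite coefB coefZ -/(lead_coef p) -[in q`_ _]sp -/(lead_coef q) divfK ?subrr ?lead_coef_eq0.
rewrite nth_default // (leq_trans (size_polyD _ _)) // size_polyN geq_max.
by rewrite size_scale // sp andbb -(@prednK (size p)) ?size_poly_gt0.
Qed.

Lemma deriv_prod_XsubC (I : finType) (P : pred I) (a : I -> F) x :
  (forall i, P i -> x != a i) ->
  (\prod_(i | P i) ('X - (a i)%:P))^`().[x] =
  (\prod_(i | P i) ('X - (a i)%:P)).[x] * \sum_(i | P i) (x - a i)^-1.
Proof.
move=> xa; elim/big_rec2: _ => [|i s p Pi IH]; first by rewrite derivE horner0 mulr0.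
rewrite derivM hornerD !hornerM IH derivXsubC hornerXsubC hornerC.
by field; rewrite subr_eq0 xa.
Qed.

End Wronskian.

(** * Real members of a pencil *)

Section RealMember.
Variable C : numClosedFieldType.
Implicit Types p q : {poly C}.

Lemma poly_vanish_eq0 p n (z : 'I_n -> C) :
  injective z -> (forall k, p.[z k] = 0) -> (size p <= n)%N -> p = 0.
Proof.
move=> z_inj pz sp; apply: (@roots_geq_poly_eq0 _ _ [seq z k | k : 'I_n]).
- by apply/allP => _ /imageP[k _ ->]; apply/eqP.
- by rewrite map_inj_uniq ?enum_uniq.
by rewrite size_image card_ord.
Qed.

Lemma horner_map_conj p x : x \is Num.real ->
  (map_poly Num.conj p).[x] = p.[x]^*.
Proof. by move=> xr; rewrite -{1}(conj_Creal xr) horner_map. Qed.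

(** The roots of p satisfy the Bethe equations: at a root of p the Wronskian W
    equals - p' q and its derivative equals - p'' q, so that W' / W = p'' / p'. *)
Lemma pencil_member_real m (z : 'I_m.*2 -> C) p q :
  injective z -> (forall k, z k \is Num.real) ->
  (size p <= m.+1)%N -> (size q <= m.+2)%N -> wronskian p q != 0 ->
  (forall k, (wronskian p q).[z k] = 0) -> (forall k, p.[z k] != 0) ->
  exists2 c, c != 0 & c *: p \is a polyOver Num.real.
Proof.
move=> z_inj z_real sp sq W0 Wz pz.
(* Otherwise W has degree less than 2m, too small for its 2m zeros. *)
have pm : p`_m != 0.
  apply: contra_neq W0 => pm; apply: (poly_vanish_eq0 z_inj Wz).
  rewrite -[m.*2]/(m.*2.+1.-1) -addnn -addnS.
  by apply: wronskian_top_eq0; rewrite // pm mul0r mulr0.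
have {}sp : size p = m.+1.
  by apply/eqP; rewrite eqn_leq sp ltnNge; apply: contra_neqN pm => h; rewrite nth_default.
have p0 : p != 0 by rewrite -size_poly_gt0 sp.
have [r p_r] := closed_field_poly_normal p.
have l0 : lead_coef p != 0 by rewrite lead_coef_eq0.
have szr : size r = m.
  by apply/eq_add_S; rewrite -sp p_r size_scale // size_prod_XsubC.
pose t (i : 'I_m) := r`_i.
pose P := \prod_i ('X - (t i)%:P).
have {p_r} pP : p = lead_coef p *: P.
  by rewrite [LHS]p_r (big_nth 0) szr big_mkord.
have Pt i : P = ('X - (t i)%:P) * \prod_(j | j != i) ('X - (t j)%:P).
  by rewrite /P (bigD1 i).
have zt i k : z k != t i.
  apply: contra_neq (pz k) => ->.
  by rewrite pP hornerZ (Pt i) hornerM hornerXsubC subrr mul0r mulr0.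
pose Z := \prod_k ('X - (z k)%:P).
have [w WZ] : exists w, wronskian p q = w *: Z.
  have [||g Wg] := @uniq_roots_prod_XsubC _ (wronskian p q) [seq z k | k : 'I_m.*2].
  - by apply/allP => _ /imageP[k _ ->]; apply/eqP.
  - by rewrite uniq_rootsE map_inj_uniq ?enum_uniq.
  have {}Wg : wronskian p q = g * Z by rewrite Wg big_image.
  have g0 : g != 0 by apply: contra_neq W0; rewrite Wg => ->; rewrite mul0r.
  exists g`_0; rewrite -mul_polyC -size1_polyC //.
  have : (size (wronskian p q) <= m.*2.+1)%N.
    by rewrite -addnn -addnS size_wronskian ?sp.
  have sZ : size Z = m.*2.+1 by rewrite /Z -big_enum size_prod_XsubC -cardE card_ord.
  rewrite Wg size_mul // -?size_poly_gt0 ?sZ // addnS /=.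
  by rewrite -[X in (_ <= X)%N]add1n leq_add2r.
have Wt i : (wronskian p q).[t i] != 0.
  rewrite WZ hornerZ mulf_neq0 //.
    by apply: contra_neq W0 => w0; rewrite WZ w0 scale0r.
  rewrite horner_prod; apply/prodf_neq0 => k _.
  by rewrite hornerXsubC subr_eq0 eq_sym zt.
(* A double root of p is a zero of W, hence one of the z k. *)
have t_inj : injective t.
  move=> i j; apply: contraPeq => ij.
  move/eqP: (Wt i); apply: contra_not => tij.
  have PQ : P = ('X - (t i)%:P) * (('X - (t j)%:P) *
      \prod_(k | (k != i) && (k != j)) ('X - (t k)%:P)).
    by rewrite (Pt i) (bigD1 j) // eq_sym.
  rewrite /wronskian pP PQ -tij.
  by rewrite !derivE !hornerE !subrr /=; ring.
pose S i := \sum_(j | j != i) (t i - t j)^-1.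
have bethe i : \sum_k (t i - z k)^-1 = 2 * S i.
  set Q := \prod_(j | j != i) ('X - (t j)%:P).
  have tij j : j != i -> t i != t j by rewrite (inj_eq t_inj) eq_sym.
  have p1 : p^`().[t i] = lead_coef p * Q.[t i].
    rewrite {1}pP (Pt i) -/Q !derivE !hornerE subrr /=; ring.
  have p2 : p^`()^`().[t i] = lead_coef p * (2 * (Q.[t i] * S i)).
    rewrite -deriv_prod_XsubC // -/Q {1}pP (Pt i) -/Q !derivE !hornerE subrr /=; ring.
  have pt : p.[t i] = 0.
    by rewrite {1}pP (Pt i) hornerZ hornerM hornerXsubC subrr mul0r mulr0.
  have W1 : (wronskian p q)^`().[t i] = (wronskian p q).[t i] * \sum_k (t i - z k)^-1.
    rewrite WZ derivZ !hornerZ deriv_prod_XsubC ?mulrA // => k _.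
    by rewrite eq_sym zt.
  have Wti : (wronskian p q).[t i] = - (p^`().[t i] * q.[t i]).
    by rewrite /wronskian !hornerE pt mul0r sub0r.
  have W2 : (wronskian p q)^`().[t i] = - (p^`()^`().[t i] * q.[t i]).
    by rewrite /wronskian !derivE !hornerE pt /=; ring.
  apply: (mulfI (Wt i)); rewrite -W1 W2 Wti p1 p2.
  by ring.
have r_real k : \sum_i (z k - t i)^-1 \is Num.real.
  apply: (gaudin_real t_inj z_inj) => // i.
  rewrite -[LHS]opprK -sumrN (eq_bigr (fun k => (t i - z k)^-1)); last first.
    by move=> k' _; rewrite -invrN opprB.
  rewrite bethe /S -mulrN -sumrN mulr_sumr; apply: eq_bigr => j _.
  by rewrite -invrN opprB.
(* P and its conjugate have the same logarithmic derivative at each z k. *)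
pose Pc := map_poly Num.conj P.
have sP : size P = m.+1 by rewrite /P -big_enum size_prod_XsubC -cardE card_ord.
have sPc : size Pc = m.+1 by rewrite size_map_poly.
have Pz k : P^`().[z k] = P.[z k] * \sum_i (z k - t i)^-1.
  by apply: deriv_prod_XsubC => i _; apply: zt.
have WP0 : wronskian P Pc = 0.
  apply: (poly_vanish_eq0 z_inj) => [k|]; last first.
    by rewrite -addnn size_wronskian ?sP ?sPc.
  rewrite /wronskian deriv_map !hornerE !horner_map_conj // Pz rmorphM /=.
  by rewrite (conj_Creal (r_real k)); ring.
have P_monic : lead_coef P = 1 by apply/eqP; apply: monic_prod_XsubC.
have P0 : P != 0 by rewrite -size_poly_gt0 sP.
have [c Pc_c] := wronskian_eq0 P0 WP0.
exists (lead_coef p)^-1; first by rewrite invr_eq0.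
have c1 : c = 1.
  have := congr1 (fun u : {poly C} => lead_coef u) Pc_c.
  by rewrite lead_coefZ lead_coef_map P_monic rmorph1 mulr1.
rewrite [X in _ *: X]pP scalerA mulVf // scale1r; apply/polyOverP => i; apply/CrealP.
by rewrite -coef_map -/Pc Pc_c c1 scale1r.
Qed.

End RealMember.

(** * Sending a real point to infinity *)

Section Mobius.
Variables (F : numFieldType) (n : nat).
Local Notation d := n.+1.
Implicit Types (p q : {poly F}) (z : option F) (x : F).

(** The values of p and of its derivative in the chart of the projective line
    around z, for p seen as a form of degree d; at infinity the coordinate is
    1 / z, and these are the two leading coefficients. *)
Definition hval z p := if z is Some a then p.[a] else p`_d.
Definition hderiv z p := if z is Some a then p^`().[a] else p`_n.
Definition hwronskian z p q := hval z p * hderiv z q - hderiv z p * hval z q.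

Definition shift_poly x p := p \Po ('X + x%:P).
Definition rev_poly p := \poly_(i < d.+1) p`_(d - i).
(** The form p in the coordinate w = 1 / (z - x): this is w^d p(x + 1/w). *)
Definition to_infty x p := rev_poly (shift_poly x p).
Definition to_infty_pt x z := if z is Some a then (a - x)^-1 else 0.

Lemma coef_XaddC_exp x i j : (('X + x%:P) ^+ i)`_j = x ^+ (i - j) *+ 'C(i, j).
Proof.
rewrite addrC exprDn coef_sum.
under eq_bigr do rewrite coefMn -polyC_exp coefCM coefXn.
have [ij|ji] := ltnP i j.
  rewrite bin_small // mulr0n big1 // => k _.
  by rewrite gtn_eqF ?mulr0 ?mul0rn // (leq_trans _ ij) // ltnS -ltnS.
rewrite (bigD1 (Ordinal (ji : (j < i.+1)%N))) //= eqxx mulr1 big1 ?addr0 //.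
by move=> k; rewrite -val_eqE /= eq_sym => /negPf ->; rewrite mulr0 mul0rn.
Qed.

Lemma coef_shift_poly x p j : (size p <= d.+1)%N ->
  (shift_poly x p)`_j = \sum_(i < d.+1) p`_i * (x ^+ (i - j) *+ 'C(i, j)).
Proof.
move=> sp; rewrite coef_comp_poly.
under eq_bigr do rewrite coef_XaddC_exp.
rewrite (big_ord_widen _ (fun i => p`_i * (x ^+ (i - j) *+ 'C(i, j))) sp).
rewrite big_mkcond; apply: eq_big => i; rewrite ?ltn_ord //.
by case: ltnP => // h _; rewrite nth_default ?mul0r.
Qed.

Lemma shift_poly_top x p : (size p <= d.+1)%N -> (shift_poly x p)`_d = p`_d.
Proof.
move=> sp; rewrite coef_shift_poly // big_ord_recr /= subnn binn mulr1.
by rewrite big1 ?add0r // => i _; rewrite bin_small // mulr0n mulr0.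
Qed.

Lemma shift_poly_subtop x p : (size p <= d.+1)%N ->
  (shift_poly x p)`_n = p`_n + d%:R * x * p`_d.
Proof.
move=> sp; rewrite coef_shift_poly // big_ord_recr /= subSnn expr1 binSn.
rewrite big_ord_recr /= subnn binn mulr1.
rewrite big1 ?add0r => [|i _]; last by rewrite bin_small // mulr0n mulr0.
by rewrite -mulr_natl; ring.
Qed.

Lemma size_shift_poly x p : size (shift_poly x p) = size p.
Proof. by rewrite size_comp_poly2 // size_XaddC. Qed.

Lemma horner_rev_poly p b : (size p <= d.+1)%N -> b != 0 ->
  (rev_poly p).[b^-1] = b^-1 ^+ d * p.[b].
Proof.
move=> sp b0; rewrite horner_poly (horner_coef_wide _ sp) mulr_sumr.
rewrite (reindex_inj rev_ord_inj); apply: eq_bigr => i _ /=.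
have id : (i <= d)%N by rewrite -ltnS.
rewrite subSS subKn // mulrCA; congr (_ * _).
by rewrite exprB ?unitfE ?invr_eq0 // -exprVn invrK.
Qed.

Lemma deriv_rev_poly p :
  'X * (rev_poly p)^`() = d%:R *: rev_poly p - rev_poly ('X * p^`()).
Proof.
apply/polyP => i; rewrite coefXderiv coefB coefZ !coef_poly.
case: ltnP => [id|_]; last by rewrite !mulr0 subr0.
by rewrite coefXderiv natrB // -mulrBl opprB addrCA subrr addr0.
Qed.

Lemma horner_deriv_rev_poly p b : (size p <= d.+1)%N -> b != 0 ->
  (rev_poly p)^`().[b^-1] = b^-1 ^+ d * (d%:R * b * p.[b] - b ^+ 2 * p^`().[b]).
Proof.
move=> sp b0; have bV0 : b^-1 != 0 by rewrite invr_eq0.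
apply: (mulfI bV0); have := congr1 (horner^~ b^-1) (deriv_rev_poly p).
rewrite hornerM hornerX => ->.
rewrite hornerD hornerN hornerZ !horner_rev_poly ?size_Xderiv //.
by rewrite hornerM hornerX; field.
Qed.

Lemma size_to_infty x p : (size (to_infty x p) <= d.+1)%N.
Proof. exact: size_poly. Qed.

Lemma to_infty_comb x a b p q :
  to_infty x (a *: p + b *: q) = a *: to_infty x p + b *: to_infty x q.
Proof.
rewrite /to_infty /shift_poly comp_polyD !comp_polyZ.
apply/polyP => i; rewrite !(coef_poly, coefD, coefZ).
by case: ifP => // _; rewrite !mulr0 addr0.
Qed.

Lemma to_infty_val x z p : (size p <= d.+1)%N -> z != Some x ->
  ((to_infty x p).[to_infty_pt x z] == 0) = (hval z p == 0).
Proof.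
case: z => [a|] sp zx; last first.
  by rewrite horner_coef0 coef_poly /= subn0 shift_poly_top.
have b0 : a - x != 0 by rewrite subr_eq0.
rewrite /= horner_rev_poly ?size_shift_poly // mulf_eq0 expf_eq0 invr_eq0.
by rewrite (negPf b0) andbF horner_comp !hornerE subrK.
Qed.

Lemma to_infty_wronskian x z p q : (size p <= d.+1)%N -> (size q <= d.+1)%N ->
  z != Some x ->
  ((wronskian (to_infty x p) (to_infty x q)).[to_infty_pt x z] == 0) =
  (hwronskian z p q == 0).
Proof.
case: z => [a|] sp sq zx; last first.
  rewrite /wronskian hornerD hornerN !hornerM /= !horner_coef0 !coef_deriv.
  rewrite !mulr1n !coef_poly /= !subn0 !subn1 /= !shift_poly_top //.
  rewrite !shift_poly_subtop // /hwronskian /=; congr (_ == 0).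
  by ring.
have b0 : a - x != 0 by rewrite subr_eq0.
rewrite /wronskian /hwronskian hornerD hornerN !hornerM /=.
rewrite !horner_rev_poly ?horner_deriv_rev_poly ?size_shift_poly //.
rewrite !deriv_comp !horner_comp !hornerM !horner_comp !derivE !hornerE !subrK /=.
set b := a - x; set w := b^-1 ^+ d.
rewrite [X in X == 0](_ : _ = - (w ^+ 2 * b ^+ 2) *
   (p.[a] * q^`().[a] - p^`().[a] * q.[a])); last by ring.
have w0 : w != 0 by rewrite expf_neq0 // invr_eq0.
by rewrite mulf_eq0 oppr_eq0 mulf_eq0 !sqrf_eq0 (negPf b0) (negPf w0).
Qed.

End Mobius.

(** * A real basis of the pencil *)

Section RealBasis.
Variables (C : numClosedFieldType) (m : nat).
Local Notation d := m.+1.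
Implicit Types (p q g : {poly C}).

Lemma to_infty_real x p : x \is Num.real -> (size p <= d.+1)%N ->
  to_infty m x p \is a polyOver Num.real -> p \is a polyOver Num.real.
Proof.
move=> xr sp /polyOverP Tp.
have -> : p = shift_poly x p \Po ('X - x%:P).
  by rewrite -comp_polyA comp_polyD comp_polyX comp_polyC subrK comp_polyXr.
rewrite polyOver_comp ?polyOverXsubC //; apply/polyOverP => i.
have [id|id] := leqP i d; last first.
  by rewrite nth_default ?rpred0 // size_shift_poly (leq_trans sp).
by have := Tp (d - i)%N; rewrite coef_poly ltnS leq_subr subKn.
Qed.

Lemma exists_real_nonroot g : g != 0 -> exists2 x, x \is Num.real & g.[x] != 0.
Proof.
move=> g0; pose z (k : 'I_(size g)) : C := k%:R.
have z_inj : injective z by move=> j k /eqP; rewrite eqr_nat => /eqP /val_inj.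
have [k gk|all0] := pickP (fun k => g.[z k] != 0).
  by exists (z k); rewrite ?realn.
have := poly_vanish_eq0 z_inj (fun k => eqP (negbFE (all0 k))) (leqnn _).
by move/eqP; rewrite (negPf g0).
Qed.

Lemma to_infty_wronskian_neq0 x p q : x \is Num.real ->
  (size p <= d.+1)%N -> (size q <= d.+1)%N ->
  wronskian p q != 0 -> wronskian (to_infty m x p) (to_infty m x q) != 0.
Proof.
move=> xr sp sq W0.
have [a _] : exists2 a, a \is Num.real & (wronskian p q * ('X - x%:P)).[a] != 0.
  by apply: exists_real_nonroot; rewrite mulf_neq0 ?polyXsubC_eq0.
rewrite hornerM hornerXsubC mulf_eq0 negb_or subr_eq0 => /andP[Wa ax].
have := to_infty_wronskian sp sq (ax : Some a != Some x).
rewrite /hwronskian /= -!hornerM -hornerN -hornerD -/(wronskian p q) (negPf Wa).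
by move=> h; apply: contraFneq h => ->; rewrite horner0.
Qed.

Lemma to_infty_pt_inj (x : C) (y z : option C) : y != Some x -> z != Some x ->
  to_infty_pt x y = to_infty_pt x z -> y = z.
Proof.
case: y z => [a|] [b|] //= ax bx.
- by move/invr_inj/addIr ->.
- by move/eqP; rewrite invr_eq0 subr_eq0 => /eqP e; rewrite e eqxx in ax.
- by move/esym/eqP; rewrite invr_eq0 subr_eq0 => /eqP e; rewrite e eqxx in bx.
Qed.

Section Pencil.
Variables (p q : {poly C}) (z : 'I_m.*2 -> option C).
Hypotheses (sp : (size p <= d.+1)%N) (sq : (size q <= d.+1)%N).
Hypotheses (W0 : wronskian p q != 0) (z_inj : injective z).
Hypotheses (z_real : forall k, odflt 0 (z k) \is Num.real).
Hypotheses (Wz : forall k, hwronskian m (z k) p q = 0).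

(** A common zero of p and q would be a double zero of the Wronskian, which then
    would have more zeros than its degree allows. *)
Lemma no_base_point k : (hval m (z k) p != 0) || (hval m (z k) q != 0).
Proof.
(* In the coordinate 1 / (z - x) all the points are finite. *)
have [x xr] : exists2 x, x \is Num.real &
    (\prod_j ('X - (odflt 0 (z j))%:P)).[x] != 0.
  by apply/exists_real_nonroot/prodf_neq0 => j _; rewrite polyXsubC_eq0.
rewrite horner_prod => /prodf_neq0 zx.
have {}zx j : z j != Some x.
  apply: contraTneq (zx j isT) => -> /=.
  by rewrite hornerXsubC subrr eqxx.
pose w j := to_infty_pt x (z j).
have w_inj : injective w by move=> i j /to_infty_pt_inj e; apply/z_inj/e.
rewrite -negb_and; apply: contraL (to_infty_wronskian_neq0 xr sp sq W0).
rewrite -!(to_infty_val _ (zx k)) // -/(w k) negbK.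
have factor (u : {poly C}) : (size u <= d.+1)%N -> u.[w k] == 0 ->
    exists2 v : {poly C}, (size v <= d)%N & u = v * ('X - (w k)%:P).
  move=> su /factor_theorem[v uv]; exists v => //.
  have [->|v0] := eqVneq v 0; first by rewrite size_poly0.
  by move: su; rewrite uv size_Mmonic ?monicXsubC // size_XsubC addn2.
case/andP=> /factor[|P1 sP1 eP]; first exact: size_to_infty.
move=> /factor[|Q1 sQ1 eQ]; first exact: size_to_infty.
have WM : wronskian (to_infty m x p) (to_infty m x q) =
    wronskian P1 Q1 * ('X - (w k)%:P) ^+ 2.
  by rewrite eP eQ /wronskian !derivM !derivXsubC; ring.
suff W10 : wronskian P1 Q1 = 0 by rewrite WM W10 mul0r eqxx.
apply: (@roots_geq_poly_eq0 _ _ [seq w j | j in predC1 k]).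
- apply/allP => _ /imageP[j jk ->]; apply/eqP.
  have : (wronskian (to_infty m x p) (to_infty m x q)).[w j] == 0.
    by rewrite to_infty_wronskian ?Wz.
  rewrite WM hornerM horner_exp hornerXsubC mulf_eq0 sqrf_eq0 subr_eq0.
  by rewrite (inj_eq w_inj) (negPf (jk : j != k)) orbF => /eqP.
- by rewrite map_inj_uniq ?enum_uniq.
by rewrite size_image cardC1 card_ord -addnn size_wronskian_diag.
Qed.

(** The zeros of the witness g are those of p, the given finite points, and the
    points x for which the member vanishing at x also vanishes at a given
    point. *)
Lemma generic_member_real : exists2 g : {poly C}, g != 0 &
  forall x, x \is Num.real -> g.[x] != 0 ->
  exists2 c, c != 0 & c *: (p.[x] *: q - q.[x] *: p) \is a polyOver Num.real.
Proof.
pose e k := hval m (z k) q *: p - hval m (z k) p *: q.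
exists (p * \prod_k e k * \prod_k ('X - (odflt 0 (z k))%:P)).
  rewrite !mulf_neq0 //.
  - by apply: contra_neq W0 => ->; rewrite /wronskian derivE !mul0r subr0.
  - apply/prodf_neq0 => k _; apply: contraTneq (no_base_point k) => ek.
    rewrite -negb_and negbK.
    have := wronskian_comb (hval m (z k) q) (- hval m (z k) p) 0 1 p q.
    have := wronskian_comb 1 0 (hval m (z k) q) (- hval m (z k) p) p q.
    rewrite !scaleNr -/(e k) ek /wronskian derivE !mul0r !mulr0 subrr.
    rewrite !subr0 mul1r mulr1 -/(wronskian p q) => /esym/eqP h1 /esym/eqP h2.
    move: h1 h2; rewrite scaleNr oppr_eq0 !scaler_eq0 (negPf W0) !orbF.
    by move=> -> ->.
  - by apply/prodf_neq0 => k _; rewrite polyXsubC_eq0.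
move=> x xr; rewrite !hornerM !mulf_eq0 !negb_or !horner_prod.
move=> /andP[/andP[px /prodf_neq0 ex] /prodf_neq0 zx].
have {}zx k : z k != Some x.
  by apply: contraTneq (zx k isT) => -> /=; rewrite hornerXsubC subrr eqxx.
set N := _ - _.
have N_comb : N = - q.[x] *: p + p.[x] *: q by rewrite scaleNr addrC.
have sN : (size N <= d.+1)%N.
  rewrite (leq_trans (size_polyD _ _)) // size_polyN geq_max.
  by rewrite !(leq_trans (size_scale_leq _ _)).
have sTN : (size (to_infty m x N) <= d)%N.
  apply/leq_sizeP => i; rewrite leq_eqVlt => /predU1P[<-|id]; last first.
    by rewrite nth_default // (leq_trans (size_to_infty _ _ _)).
  rewrite coef_poly ltnSn subnn -horner_coef0 horner_comp !hornerE.
  by rewrite mulrC subrr.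
(* N vanishes at x, so it loses a degree there; p completes it to a basis. *)
have WT : wronskian (to_infty m x N) (to_infty m x p) =
    - p.[x] *: wronskian (to_infty m x p) (to_infty m x q).
  have := wronskian_comb (- q.[x]) p.[x] 1 0 (to_infty m x p) (to_infty m x q).
  by rewrite -!to_infty_comb -N_comb scale1r scale0r addr0 mulr0 mulr1 sub0r.
have w_inj : injective (fun k => to_infty_pt x (z k)).
  by move=> i j /to_infty_pt_inj h; apply/z_inj/h.
have [k||k|k|c c0 cN] := pencil_member_real w_inj _ sTN (size_to_infty _ x p).
- rewrite /to_infty_pt; move: (z_real k).
  by case: (z k) => //= a ar; rewrite realV realB.
- by rewrite WT scaler_eq0 oppr_eq0 negb_or px to_infty_wronskian_neq0.
- apply/eqP; rewrite WT hornerZ mulf_eq0; apply/orP; right.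
  by rewrite to_infty_wronskian ?Wz.
- rewrite to_infty_val //; apply: contraNneq (ex k isT) => Nk.
  rewrite -Nk /e /N /hval; case: (z k) => [a|]; rewrite !hornerE ?coefB ?coefZ.
    by rewrite [q.[a] * _]mulrC [p.[a] * _]mulrC.
  by rewrite [q`__ * _]mulrC [p`__ * _]mulrC.
exists c => //; apply: to_infty_real xr _ _.
  by rewrite (leq_trans (size_scale_leq _ _)).
have := to_infty_comb m x c 0 N 0.
by rewrite !scale0r !addr0 => ->; apply: cN.
Qed.

(** The members vanishing at x and at y are independent when the first one does
    not vanish at y. *)
Lemma real_basis : exists p1 q1 : {poly C}, exists a b c e,
  [/\ p1 = a *: p + b *: q, q1 = c *: p + e *: q, a * e - b * c != 0,
      p1 \is a polyOver Num.real & q1 \is a polyOver Num.real].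
Proof.
have [g g0 gen] := generic_member_real.
have p0 : p != 0.
  by apply: contra_neq W0 => ->; rewrite /wronskian derivE !mul0r subr0.
have [x xr] := exists_real_nonroot (mulf_neq0 g0 p0).
rewrite hornerM mulf_eq0 negb_or => /andP[gx px].
set N := p.[x] *: q - q.[x] *: p.
have N0 : N != 0.
  have := wronskian_comb 1 0 (- q.[x]) p.[x] p q.
  rewrite scale1r scale0r addr0 scaleNr addrC -/N mul1r mul0r subr0 => WN.
  have : wronskian p N != 0 by rewrite WN scaler_eq0 negb_or px.
  by apply: contra_neq => ->; rewrite /wronskian derivE !mulr0 subr0.
have [y yr] := exists_real_nonroot (mulf_neq0 g0 N0).
rewrite hornerM mulf_eq0 negb_or => /andP[gy Ny].
have [c1 c10 real1] := gen x xr gx.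
have [c2 c20 real2] := gen y yr gy.
exists (c1 *: N), (c2 *: (p.[y] *: q - q.[y] *: p)).
exists (- c1 * q.[x]), (c1 * p.[x]), (- c2 * q.[y]), (c2 * p.[y]); split=> //.
- by rewrite /N scalerBr !scalerA mulNr scaleNr addrC.
- by rewrite scalerBr !scalerA mulNr scaleNr addrC.
have -> : - c1 * q.[x] * (c2 * p.[y]) - c1 * p.[x] * (- c2 * q.[y]) =
  c1 * c2 * N.[y] by rewrite /N !hornerE /=; ring.
by rewrite !mulf_neq0.
Qed.

End Pencil.
End RealBasis.

(** * Subspaces of codimension 2 and tangent lines *)

Section Codim2.
Variables (F : fieldType) (n : nat).

Definition pairing (u : 'rV[F]_n) (p : {poly F}) := \sum_i u 0 i * p`_i.

Lemma pairing_comb u a b p q :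
  pairing u (a *: p + b *: q) = a * pairing u p + b * pairing u q.
Proof.
rewrite /pairing !mulr_sumr -big_split; apply: eq_bigr => i _ /=.
by rewrite coefD !coefZ; ring.
Qed.

Lemma pairing_basis_change u a b c e p q : a * e - b * c != 0 ->
  (pairing u (a *: p + b *: q) == 0) && (pairing u (c *: p + e *: q) == 0) =
  (pairing u p == 0) && (pairing u q == 0).
Proof.
move=> det; rewrite !pairing_comb; set x := pairing u p; set y := pairing u q.
apply/andP/andP => [[/eqP h1 /eqP h2]|[/eqP-> /eqP->]]; last first.
  by rewrite !mulr0 addr0.
have ex : (a * e - b * c) * x = e * (a * x + b * y) - b * (c * x + e * y).
  by ring.
have ey : (a * e - b * c) * y = a * (c * x + e * y) - c * (a * x + b * y).
  by ring.
by split; apply/eqP/(mulfI det); rewrite ?ex ?ey h1 h2 !mulr0 subrr.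
Qed.

Lemma pairingDl a b u v p :
  pairing (a *: u + b *: v) p = a * pairing u p + b * pairing v p.
Proof.
rewrite /pairing !mulr_sumr -big_split; apply: eq_bigr => i _ /=.
by rewrite !mxE; ring.
Qed.

(** The equations are the coordinates of the projection onto a complement of V
    along V. *)
Lemma codim2_equations (V : {vspace 'rV[F]_n}) : (\dim V + 2)%N = n ->
  exists p q : {poly F}, [/\ (size p <= n)%N, (size q <= n)%N,
    forall u, (u \in V) = (pairing u p == 0) && (pairing u q == 0) &
    forall a b, a *: p + b *: q = 0 -> a = 0 /\ b = 0].
Proof.
move=> dimV; pose U := (V^C)%VS.
have dimU : \dim U = 2.
  by rewrite dimv_compl dimvf /dim /= mul1n -[X in (X - _)%N]dimV addKn.
pose X := tcast dimU (vbasis U).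
have Xbasis : basis_of U X by rewrite val_tcast vbasisP.
have VU0 : (V :&: U = 0)%VS by apply: capv_compl.
have UV0 : (U :&: V = 0)%VS by rewrite capvC.
have UVT u : u \in (U + V)%VS by rewrite addvC addv_complf memvf.
pose pi := daddv_pi U V.
have piU u : pi u \in U by apply: memv_pi.
have piV u : (u \in V) = (pi u == 0).
  apply/idP/eqP => [uV|pu0]; have := daddv_pi_add UV0 (UVT u).
    by rewrite (daddv_pi_id VU0 uV) => /(canRL (addrK _)); rewrite subrr.
  by rewrite -/pi pu0 add0r => <-; apply: memv_pi.
pose f i u := coord X i (pi u).
pose P i : {poly F} := \poly_(j < n) (if insub j is Some j' then f i (delta_mx 0 (j' : 'I_n)) else 0).
have pairP u i : pairing u (P i) = f i u.
  rewrite {2}[u]row_sum_delta /f !linear_sum; apply: eq_bigr => j _ /=.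
  by rewrite !linearZ /= coef_poly ltn_ord valK.
have fX (i j : 'I_2) : f i X`_j = (i == j)%:R.
  have XU : X`_j \in U by apply: (basis_mem Xbasis); rewrite mem_nth ?size_tuple.
  by rewrite /f /pi daddv_pi_id // coord_free ?(basis_free Xbasis) // eq_sym.
exists (P ord0), (P (lift ord0 ord0)); split.
- exact: size_poly.
- exact: size_poly.
- move=> u; rewrite piV !pairP; apply/eqP/andP => [pu0|[/eqP f0 /eqP f1]].
    by rewrite /f pu0 !linear0.
  rewrite (coord_basis Xbasis (piU u)) !big_ord_recl big_ord0.
  by rewrite -/(f _ u) -/(f _ u) f0 f1 !scale0r !addr0.
move=> a b ab0.
have H (j : 'I_2) : a * (ord0 == j)%:R + b * (lift ord0 ord0 == j)%:R = 0.
  rewrite -!fX -!pairP -pairing_comb ab0 /pairing big1 // => i _.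
  by rewrite coef0 mulr0.
by split; [move: (H ord0) | move: (H (lift ord0 ord0))];
   rewrite /= mulr1 mulr0 ?addr0 ?add0r.
Qed.

End Codim2.

Section TangentLine.
Variables (F : numFieldType) (n : nat).
Local Notation d := n.+1.

Lemma pairing_rnc (z : option F) (p : {poly F}) : (size p <= d.+1)%N ->
  pairing (rnc d z) p = hval n z p.
Proof.
case: z => [a|] sp /=.
  rewrite (horner_coef_wide _ sp); apply: eq_bigr => i _.
  by rewrite mxE mulrC.
rewrite /pairing (bigD1 ord_max) //= mxE !eqxx mul1r big1 ?addr0 // => i ne.
by rewrite mxE (negPf ne) andbF mul0r.
Qed.

Lemma pairing_rnc_velocity (z : option F) (p : {poly F}) : (size p <= d.+1)%N ->
  pairing (rnc_velocity d z) p = hderiv n z p.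
Proof.
case: z => [a|] sp; rewrite /pairing /rnc_velocity /=.
  have pE : p = \sum_(i < d.+1) p`_i *: 'X^i.
    rewrite -poly_def; apply/polyP => i; rewrite coef_poly.
    by case: ltnP => // id; rewrite nth_default // (leq_trans sp).
  rewrite {2}pE (raddf_sum (@deriv F)) horner_sum; apply: eq_bigr => i _.
  by rewrite !mxE /= derivZ hornerZ mulrC.
have nd : (n < d.+1)%N by [].
rewrite (bigD1 (Ordinal nd)) //= !mxE /= subSn // subnn derivX hornerC mul1r.
rewrite big1 ?addr0 // => i; rewrite -val_eqE /= => ine.
rewrite !mxE derivXn hornerMn hornerXn expr0n.
have [id|] := eqVneq (i : nat) d; first by rewrite id subnn mulr0n mul0r.
move=> id; have {}id : (i < n)%N by have := ltn_ord i; lia.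
by rewrite gtn_eqF ?mul0rn ?mul0r //; lia.
Qed.

Lemma tangent_line_hwronskian (V : {vspace 'rV[F]_d.+1}) z (p q : {poly F}) :
  (size p <= d.+1)%N -> (size q <= d.+1)%N ->
  (forall u, u \in V -> pairing u p = 0 /\ pairing u q = 0) ->
  proj_intersect V (rnc_tangent_line d z) -> hwronskian n z p q = 0.
Proof.
move=> sp sq Vpq [u [u0 /Vpq[up uq]]].
rewrite /rnc_tangent_line span_cons span_seq1.
case/memv_addP => _ /vlineP[a ->] [_ /vlineP[b ->] u_ab].
move: up uq; rewrite u_ab !pairingDl !pairing_rnc // !pairing_rnc_velocity //.
move=> ep eq; rewrite /hwronskian.
have [a0|a0] := eqVneq a 0; last first.
  apply: (mulfI a0); rewrite mulr0 mulrBr !mulrA.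
  rewrite (canRL (addrK _) ep) [_ * hderiv _ _ _ * _]mulrAC (canRL (addrK _) eq).
  by ring.
have [b0|b0] := eqVneq b 0; first by move: u0; rewrite u_ab a0 b0 !scale0r addr0 eqxx.
by move/eqP: ep; move/eqP: eq; rewrite a0 !mul0r !add0r !mulf_eq0 (negPf b0) /= => /eqP -> /eqP ->; ring.
Qed.

End TangentLine.

Theorem mainTheorem3 (R : realType) (d : nat) (hd : (2 <= d)%N)
    (L : 'I_(2 * d - 2) -> {vspace 'rV[R[i]]_d.+1})
    (L_distinct : injective L)
    (L_tangent : forall k : 'I_(2 * d - 2), exists z : option R,
        L k = rnc_tangent_line d (omap (real_complex R) z))
    (V : {vspace 'rV[R[i]]_d.+1})
    (V_codim2 : (\dim V + 2)%N = d.+1)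
    (V_meets : forall k : 'I_(2 * d - 2), proj_intersect V (L k)) :
  real_subspace V.
Proof.
case: d hd L L_distinct L_tangent V V_codim2 V_meets => // m _ L L_inj L_tan V dimV V_meets.
have [p [q [sp sq Vpq indep]]] := codim2_equations dimV.
have e : m.*2 = (2 * m.+1 - 2)%N by rewrite mul2n doubleS subn2.
have [z Lz] := fin_all_exists (fun k : 'I_m.*2 => L_tan (cast_ord e k)).
pose zc k := omap (real_complex R) (z k).
have zc_inj : injective zc.
  by move=> i j ij; apply/(cast_ord_inj (eq_n := e))/L_inj; rewrite !Lz -/(zc i) ij.
have zc_real k : odflt 0 (zc k) \is Num.real.
  rewrite /zc; case: (z k) => [a|] /=; last exact: real0.
  by apply/complex_realP; exists a.
have W0 : wronskian p q != 0.
  have p0 : p != 0.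
    apply/eqP => p0; have [|/eqP + _] := indep 1 0; last by rewrite oner_eq0.
    by rewrite p0 scaler0 scale0r addr0.
  apply/eqP => /(wronskian_eq0 p0)[c qc].
  have [|_ /eqP] := indep c (-1); last by rewrite oppr_eq0 oner_eq0.
  by rewrite qc scaleN1r subrr.
have Wz k : hwronskian m (zc k) p q = 0.
  apply: (@tangent_line_hwronskian _ _ V) => // [u|]; last by rewrite -Lz.
  by rewrite Vpq => /andP[/eqP ? /eqP ?].
have [p1 [q1 [a [b [c [f [p1E q1E det /polyOverP p1r /polyOverP q1r]]]]]]] :=
  real_basis sp sq W0 zc_inj zc_real Wz.
exists 2%N, (\matrix_(i, j) complex.Re (if j == ord0 then p1`_i else q1`_i)) => u.
have entry j : (u *m map_mx (real_complex R)
    (\matrix_(i, j) complex.Re (if j == ord0 then p1`_i else q1`_i)) : 'rV_2) 0 j =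
    pairing u (if j == ord0 then p1 else q1).
  rewrite mxE; apply: eq_bigr => i _; rewrite !mxE.
  by case: (j == ord0); rewrite RRe_real.
have Vp1q1 : (u \in V) = (pairing u p1 == 0) && (pairing u q1 == 0).
  by rewrite Vpq p1E q1E pairing_basis_change.
split=> [|uA0].
  rewrite Vp1q1 => /andP[/eqP h1 /eqP h2]; apply/rowP => j.
  by rewrite entry mxE; case: (j == ord0).
rewrite Vp1q1; have := entry ord0; have := entry ord_max.
by rewrite uA0 !mxE /= => <- <-; rewrite eqxx.
Qed.
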